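(* Let $K_{m,n}$ be a complete bipartite graph with $m$ even and $n$ odd, and let $\Gamma$ be an abelian group with $2^k(m+n)$ elements, where $k\ge 2$. If $H$ is a $2r$-regular balanced distance magic graph on $2^k$ vertices and $r$ is odd, then $K_{m,n}\circ H$ is $\Gamma$-distance magic.
   Context: All graphs are finite and simple; all groups are finite additive abelian groups. $N_G(u)$ is the set of vertices adjacent to $u$ in $G$. For a graph $G$ and an abelian group $\Gamma$ with $|V(G)|=|\Gamma|$, a $\Gamma$-distance magic labeling of $G$ is a bijection $l:V(G)\to\Gamma$ for which there is an element $\mu_0\in\Gamma$ such that $w_G(u)=\sum_{v\in N_G(u)}l(v)=\mu_0$ for every $u\in V(G)$; $G$ is $\Gamma$-distance magic if it admits such a labeling. The lexicographic product $G\circ H$ has vertex set $V(G)\times V(H)$; $(g,h)$ and $(g',h')$ are adjacent iff $g$ is adjacent to $g'$ in $G$, or $g=g'$ and $h$ is adjacent to $h'$ in $H$. A graph $H$ is a balanced distance magic graph if $H$ is regular and its vertex set can be written as $\{v_i,v_i' : 1\le i\le |V(H)|/2\}$ (all these vertices being distinct) with $N_H(v_i)=N_H(v_i')$ for every $i$. *)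

(* Defs.v *)
From HB Require Import structures.
From mathcomp Require Import all_boot all_algebra.

Set Implicit Arguments.
Unset Strict Implicit.
Unset Printing Implicit Defensive.

Import GRing.Theory.
Local Open Scope ring_scope.

Record sgraph := SGraph {
  vertex :> finType;
  adj : rel vertex;
  adj_sym : symmetric adj;
  adj_irrefl : irreflexive adj
}.

Definition nbhd (G : sgraph) (u : G) : {set G} := [set v | adj u v].

Definition regular (d : nat) (G : sgraph) : Prop :=
  forall u : G, #|nbhd u| = d.

Section CompleteBipartite.
Variables m n : nat.

Definition bip_adj : rel ('I_m + 'I_n)%type := fun x y =>
  match x, y with
  | inl _, inr _ | inr _, inl _ => true
  | _, _ => false
  end.

Lemma bip_adj_sym : symmetric bip_adj.
Proof. by case=> ? []. Qed.

Lemma bip_adj_irrefl : irreflexive bip_adj.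
Proof. by case. Qed.

Definition complete_bipartite : sgraph := SGraph bip_adj_sym bip_adj_irrefl.
End CompleteBipartite.

Section Lexicographic.
Variables G H : sgraph.

Definition lex_adj : rel (G * H)%type := fun x y =>
  adj x.1 y.1 || (x.1 == y.1) && adj x.2 y.2.

Lemma lex_adj_sym : symmetric lex_adj.
Proof.
move=> x y; rewrite /lex_adj [adj x.1 _]adj_sym [adj x.2 _]adj_sym.
by rewrite [x.1 == _]eq_sym.
Qed.

Lemma lex_adj_irrefl : irreflexive lex_adj.
Proof. by move=> x; rewrite /lex_adj !adj_irrefl andbF. Qed.

Definition lexprod : sgraph := SGraph lex_adj_sym lex_adj_irrefl.
End Lexicographic.

(* The condition #|V(G)| = #|Gamma| is implied by the bijectivity of l. *)
Definition magic_labeling (G : sgraph) (Gamma : finZmodType) (l : G -> Gamma)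
    : Prop :=
  bijective l /\
  exists mu0 : Gamma, forall u : G, \sum_(v in nbhd u) l v = mu0.

Definition distance_magic (G : sgraph) (Gamma : finZmodType) : Prop :=
  exists l : G -> Gamma, magic_labeling l.

(* Bijectivity of the combined map says that the vertices v i and v' i are all
   distinct and exhaust the vertex set; in particular #|H| is even. *)
Definition balanced_distance_magic (H : sgraph) : Prop :=
  (exists d : nat, regular d H) /\
  exists v v' : 'I_(#|H|./2) -> H,
    bijective (fun s : 'I_(#|H|./2) + 'I_(#|H|./2) =>
                 match s with inl i => v i | inr i => v' i end) /\
    forall i, nbhd (v i) = nbhd (v' i).

(* Main.v *)
Require Import Defs.
From mathcomp Require Import all_boot all_algebra.

(** Every neighbourhood in H is a union of r twin pairs. So if the twin pairs have
    label sum c in each of the m copies of H on one side of K_{m,n}, and d in each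
    of the n copies on the other side, the weights are r c + 2^(k-1) n d and
    r d + 2^(k-1) m c. Doubling is not injective on Gamma, hence not surjective;
    pick y outside 2 Gamma and put d = (m + n) y, i = 2^(k-1) d, c = d + i. Then
    2 i = 0, and both weights equal r d because m is even and n and r are odd.
    Moreover c and d lie outside 2 Gamma, because m + n is odd and k >= 2, so
    x |-> c - x and x |-> d - x are fixed-point free involutions. The orbits of
    the group they generate all have the same size, 2 (if i = 0) or 4, so some
    union X of orbits has 2^k m elements. Splitting X into pairs of sum c and its
    complement into pairs of sum d gives the labelling. *)

Set Implicit Arguments.
Unset Strict Implicit.
Unset Printing Implicit Defensive.

Import GRing.Theory.

(** Each two-element orbit contributes its member of smaller rank in the enumeration of [T]; the
    rest of [X] is then the image of [R] under [f]. *)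
Lemma involution_transversal (T : finType) (f : T -> T) (X : {set T}) :
    involutive f -> (forall x, x \in X -> f x \in X) ->
    (forall x, x \in X -> f x != x) ->
  exists R : {set T}, [/\ R \subset X, #|X| = #|R| * 2
                        & forall x, x \in R -> f x \notin R].
Proof.
move=> fK fX fN.
pose R := [set x in X | enum_rank x < enum_rank (f x)].
have RX : R \subset X by apply/subsetP=> x; rewrite inE => /andP[].
have fR x : x \in R -> f x \notin R.
  by rewrite !inE fK => /andP[_ lt]; rewrite negb_and -leqNgt ltnW ?orbT.
exists R; split=> //.
have XR : X :\: R = f @: R.
  apply/setP=> x; apply/idP/imsetP => [|[y yR ->]]; last first.
    by rewrite inE fR //= fX // (subsetP RX).
  rewrite !inE => /andP[+ xX]; rewrite xX /= -leqNgt leq_eqVlt => /orP[/eqP e|lt].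
    by case/negP: (fN x xX); apply/eqP/enum_rank_inj/val_inj.
  by exists (f x); rewrite ?fK // inE fX // fK.
rewrite -(cardsID R X) (setIidPr RX) XR card_imset ?muln2 ?addnn //.
exact: can_inj fK.
Qed.

(** Greedy: the sets [O x] partition [T], so the block of a point outside a union of blocks is
    disjoint from it and can be added. *)
Lemma union_of_blocks (T : finType) (O : T -> {set T}) (s t : nat) :
    (forall x, x \in O x) -> (forall x y, y \in O x -> O y = O x) ->
    (forall x, #|O x| = s) -> s * t <= #|T| ->
  exists2 Y : {set T}, #|Y| = s * t & forall y, y \in Y -> O y \subset Y.
Proof.
move=> Oid Oeq Os; elim: t => [|t IH] le.
  by exists set0; rewrite ?cards0 ?muln0 // => y; rewrite inE.
have [|Y cY Ycl] := IH; first by apply: leq_trans le; rewrite leq_mul2l leqnSn orbT.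
(* If [Y] is everything, [le] squeezes [s * t] and [s * t.+1] together, so [Y] itself serves. *)
have [/forallP YT|/forallPn[x xY]] := boolP [forall x, x \in Y].
  have YT' : Y = setT by apply/setP=> x; rewrite YT inE.
  exists Y => //; apply/eqP; rewrite eqn_leq.
  by rewrite {1}cY leq_mul2l leqnSn orbT YT' cardsT le.
have dis : [disjoint O x & Y].
  apply/pred0P=> y /=; apply/negP=> /andP[yx /Ycl].
  by rewrite (Oeq _ _ yx) => /subsetP/(_ x (Oid x)); apply/negP.
exists (O x :|: Y).
  by rewrite cardsU disjoint_setI0 // cards0 subn0 Os cY mulnS.
move=> y; rewrite inE => /orP[/Oeq->|/Ycl sub]; first exact: subsetUl.
by rewrite subsetU // sub orbT.
Qed.

(** * Doubling and reflections in a finite abelian group *)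

Section Group.
Local Open Scope ring_scope.
Variable Gamma : finZmodType.

(** Translation by [x] permutes the group, so it preserves the sum of all elements. *)
Lemma mulrn_card (x : Gamma) : x *+ #|Gamma| = 0.
Proof.
apply: (@addrI _ (\sum_(z : Gamma) z)); rewrite addr0.
by rewrite [RHS](reindex_inj (addIr x)) /= big_split /= sumr_const.
Qed.

(** If doubling were onto, it would be injective, so negation would fix only 0; pairing the nonzero
    elements would make the order odd. *)
Lemma exists_non_double :
  ~~ odd #|Gamma| -> exists y : Gamma, forall x, x *+ 2 != y.
Proof.
have [/forallP surj|/forallPn[y]] := boolP [forall y : Gamma, [exists x, x *+ 2 == y]];
  last by rewrite negb_exists => /forallP; exists y.
have inj : injective (fun x : Gamma => x *+ 2).
  have imT : [set x *+ 2 | x : Gamma] = setT.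
    apply/setP=> y; rewrite inE; apply/imsetP.
    by have /existsP[x /eqP <-] := surj y; exists x.
  have /imset_injP I : #|[set x *+ 2 | x : Gamma]| == #|Gamma|.
    by rewrite imT cardsT.
  by move=> x y; apply: I.
have [|x|x|R [_ cR _]] := @involution_transversal Gamma (@GRing.opp Gamma) [set~ 0%R].
- exact: opprK.
- by rewrite !inE oppr_eq0.
- rewrite !inE; apply: contra => /eqP e.
  by apply/eqP/inj; rewrite mul0rn mulr2n -{1}e addNr.
- by rewrite -(cardsC [set (0 : Gamma)]) cards1 cR muln2 /= odd_double.
Qed.

Lemma reflections_closed_subset (d i : Gamma) (k m : nat) :
    (forall x, x *+ 2 != d) -> (forall x, x *+ 2 != d + i) -> i *+ 2 = 0 ->
    (2 <= k)%N -> (2 ^ k * m <= #|Gamma|)%N ->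
  exists2 X : {set Gamma}, #|X| = (2 ^ k * m)%N &
    forall x, (d - x \in X) = (x \in X) /\ (d + i - x \in X) = (x \in X).
Proof.
move=> dN ciN i2 k2 le.
have ii : i + i = 0 by rewrite -mulr2n.
have iN : - i = i by apply/esym/eqP; rewrite -addr_eq0 ii.
pose O x := [set x; d - x; x + i; d + i - x].
have memO x y : y \in O x = [|| y == x, y == d - x, y == x + i | y == d + i - x].
  by rewrite !inE !orbA.
have Oid x : x \in O x by rewrite memO eqxx.
have Oeq x y : y \in O x -> O y = O x.
  have E1 z : d - (d - z) = z by rewrite subKr.
  have E2 z : d - z + i = d + i - z by rewrite addrAC.
  have E3 z : d + i - (d - z) = z + i by rewrite -E2 E1.
  have E4 z : d - (z + i) = d + i - z by rewrite opprD addrA iN E2.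
  have E5 z : z + i + i = z by rewrite -addrA ii addr0.
  have E6 z : d + i - (z + i) = d - z by rewrite opprD addrACA subrr addr0.
  have E7 z : d - (d + i - z) = z + i by rewrite -E2 E4 E3.
  have E8 z : d + i - z + i = d - z by rewrite -E2 E5.
  have E9 z : d + i - (d + i - z) = z by rewrite subKr.
  rewrite memO => /or4P[] /eqP->; apply/setP=> z; rewrite !memO //.
  - by rewrite E1 E2 E3; do 4!case: (z == _).
  - by rewrite E4 E5 E6; do 4!case: (z == _).
  - by rewrite E7 E8 E9; do 4!case: (z == _).
have dx x : (x == d - x) = false.
  by apply/negbTE; rewrite -subr_eq0 opprB addrA subr_eq0 -mulr2n dN.
have cx x : (x == d + i - x) = false.
  by apply/negbTE; rewrite -subr_eq0 opprB addrA subr_eq0 -mulr2n ciN.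
have [s [t [Os st]]] : exists s t, (forall x, #|O x| = s) /\ (s * t = 2 ^ k * m)%N.
  (* For [i = 0] the two reflections coincide; otherwise the four listed points are distinct. As
     [2 <= k], both 2 and 4 divide [2 ^ k]. *)
  have [i0|iN0] := eqVneq i 0.
    exists 2, (2 ^ k.-1 * m)%N; split=> [x|].
      have -> : O x = [set x; d - x].
        by apply/setP=> z; rewrite memO !inE i0 !addr0; do 2!case: (z == _).
      by rewrite cards2 dx.
    by rewrite mulnA -expnS prednK // ltnW.
  exists 4, (2 ^ (k - 2) * m)%N; split=> [x|].
    rewrite /O -!setUA !cardsU1 cards1 !inE dx cx.
    have -> : (x == x + i) = false
      by rewrite -{1}(addr0 x) (inj_eq (addrI x)) eq_sym; apply/negbTE.
    (* As [- i = i], equality would make [d + i] the double of [x]. *)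
    have -> : (d - x == x + i) = false
      by rewrite subr_eq addrAC -mulr2n -{1}iN -subr_eq opprK eq_sym; apply/negbTE.
    have -> : (d - x == d + i - x) = false
      by rewrite (inj_eq (addIr _)) -{1}(addr0 d) (inj_eq (addrI d)) eq_sym; apply/negbTE.
    have -> : (x + i == d + i - x) = false
      by rewrite -addrAC (inj_eq (addIr _)) dx.
    by [].
  by rewrite mulnA -(expnD 2 2) subnKC.
have [||||X cX Xcl] := @union_of_blocks Gamma O s t => //; first by rewrite st.
exists X; first by rewrite cX.
move=> x; split; apply/idP/idP=> /Xcl/subsetP; apply; rewrite memO.
- by rewrite subKr eqxx orbT.
- by rewrite eqxx orbT.
- by rewrite subKr eqxx !orbT.
- by rewrite eqxx !orbT.
Qed.

End Group.

(** * Labellings with constant sum on twin pairs *)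

Section TwinPairs.
Local Open Scope ring_scope.
Variables (T : finType) (q : nat) (v v' : 'I_q -> T).
Let twins (s : 'I_q + 'I_q) : T := match s with inl i => v i | inr i => v' i end.
Hypothesis twins_bij : bijective twins.

Lemma sum_twins (Gamma : zmodType) (f : T -> Gamma) (c : Gamma) (P : {set T}) :
    (forall j, (v j \in P) = (v' j \in P)) -> (forall j, f (v j) + f (v' j) = c) ->
  \sum_(u in P) f u = c *+ #|P|./2.
Proof.
move=> vP fc.
(* The target is kept general: the constant 1 in [nat] then shows that [P] has twice as many
   elements as pairs. *)
have bigE (V : nmodType) (F : T -> V) :
    \sum_(u in P) F u = \sum_(j | v j \in P) (F (v j) + F (v' j)).
  rewrite (reindex twins) ?big_sumType /=; last by apply: onW_bij.
  by rewrite big_split; congr (_ + _); apply: eq_bigl => j; rewrite /= -vP.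
have -> : #|P| = (#|[pred j | v j \in P]| * 2)%N.
  by rewrite -sum1_card -sum_nat_const; apply: (bigE nat (fun=> 1%N)).
rewrite muln2 doubleK bigE -sumr_const; apply: eq_bigr => j _; apply: fc.
Qed.

(** Half of [X], a transversal [R] of the reflection in [c], labels the vertices [v j] in all
    copies; each twin gets the reflected label. *)
Lemma exists_balanced_labelling (Gamma : finZmodType) (m : nat) (c : Gamma)
    (X : {set Gamma}) :
    (forall x, x *+ 2 != c) -> (forall x, (c - x \in X) = (x \in X)) ->
    #|X| = (m * #|T|)%N ->
  exists l : 'I_m * T -> Gamma,
    [/\ injective l, forall p, l p \in X & forall i j, l (i, v j) + l (i, v' j) = c].
Proof.
move=> cN cX cardX.
have cardT2 : #|T| = (q * 2)%N.
  by rewrite -(bij_eq_card twins_bij) card_sum !card_ord addnn muln2.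
have [x|x|x _|R [RX cardR RN]] := @involution_transversal Gamma (fun x => c - x) X.
- exact: subKr.
- by rewrite cX.
- by rewrite eq_sym -subr_eq0 opprB addrA subr_eq0 -mulr2n cN.
have E : #|{: 'I_m * 'I_q}| = #|R|.
  rewrite card_prod !card_ord; apply/eqP; rewrite -(eqn_pmul2r (isT : 0 < 2)%N).
  by rewrite -cardR cardX cardT2 mulnA.
pose e p := enum_val (cast_ord E (enum_rank p)).
have eR p : e p \in R by apply: enum_valP.
have eI : injective e by move=> p1 p2 /enum_val_inj/cast_ord_inj/enum_rank_inj.
have [w wK Kw] := twins_bij.
pose l (p : 'I_m * T) :=
  match w p.2 with inl j => e (p.1, j) | inr j => c - e (p.1, j) end.
exists l; split=> [[i1 h1] [i2 h2]|[i h]|i j].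
- rewrite -(Kw h1) -(Kw h2) /l /= !wK.
  case: (w h1) (w h2) => j1 [] j2.
  + by move/eI=> [-> ->].
  + by move=> eq; case/negP: (RN _ (eR (i2, j2))); rewrite -eq eR.
  + by move=> eq; case/negP: (RN _ (eR (i1, j1))); rewrite eq eR.
  + by move/addrI/oppr_inj/eI=> [-> ->].
- by rewrite /l; case: (w _) => j; rewrite ?cX (subsetP RX).
- by rewrite /l /= -[v j]/(twins (inl j)) -[v' j]/(twins (inr j)) !wK addrC subrK.
Qed.

End TwinPairs.

(** * Neighbourhoods and weights in the product *)

Lemma nbhd_twin (H : sgraph) (h u u' : H) :
  nbhd u = nbhd u' -> (u \in nbhd h) = (u' \in nbhd h).
Proof.
by move/setP/(_ h); rewrite !inE adj_sym => ->; rewrite adj_sym.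
Qed.

(** A neighbouring copy of [H] contributes all its labels. Its sum runs over [[set: H]] so that
    [sum_twins] applies to it too. *)
Lemma lexprod_weight (G H : sgraph) (Gamma : zmodType)
    (l : lexprod G H -> Gamma) (g : G) (h : H) :
  (\sum_(w in nbhd ((g, h) : lexprod G H)) l w =
     \sum_(h' in nbhd h) l (g, h')
     + \sum_(g' in nbhd g) \sum_(h' in [set: H]) l (g', h'))%R.
Proof.
have -> : (\sum_(w in nbhd ((g, h) : lexprod G H)) l w =
    \sum_(g' : G) \sum_(h' | lex_adj (g, h) (g', h')) l (g', h'))%R.
  by rewrite pair_big_dep; apply: eq_big => [[g' h']|[g' h'] _] //; rewrite inE.
rewrite (bigD1 g) //= [X in _ = (_ + X)%R]big_mkcond [X in _ = (_ + X)%R](bigD1 g) //=.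
rewrite inE adj_irrefl add0r; congr (_ + _)%R.
  by apply: eq_bigl => h'; rewrite inE /lex_adj /= adj_irrefl eqxx.
apply: eq_bigr => g' /negbTE g'g; rewrite inE.
case: ifPn => gg'; last first.
  by rewrite big_pred0 // => h'; rewrite /lex_adj /= (negbTE gg') eq_sym g'g.
by apply: eq_bigl => h'; rewrite inE /lex_adj /= gg'.
Qed.

Lemma card_nbhd_inl (m n : nat) (a : 'I_m) :
  #|nbhd (inl a : complete_bipartite m n)| = n.
Proof.
have -> : nbhd (inl a : complete_bipartite m n) = inr @: [set: 'I_n].
  by apply/setP=> -[a'|b]; rewrite inE; apply/esym/imsetP => //; [case | exists b].
by rewrite card_imset ?cardsT ?card_ord // => ? ? [].
Qed.

Lemma card_nbhd_inr (m n : nat) (b : 'I_n) :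
  #|nbhd (inr b : complete_bipartite m n)| = m.
Proof.
have -> : nbhd (inr b : complete_bipartite m n) = inl @: [set: 'I_m].
  by apply/setP=> -[a|b']; rewrite inE; apply/esym/imsetP => //; [exists a | case].
by rewrite card_imset ?cardsT ?card_ord // => ? ? [].
Qed.

Theorem theorem3p4 (m n k r : nat) (Gamma : finZmodType) (H : sgraph)
  (m_even : ~~ odd m) (n_odd : odd n) (k_ge2 : 2 <= k)
  (card_Gamma : #|Gamma| = 2 ^ k * (m + n))
  (H_balanced : balanced_distance_magic H)
  (H_regular : regular (2 * r) H)
  (card_H : #|H| = 2 ^ k)
  (r_odd : odd r) :
  distance_magic (lexprod (complete_bipartite m n) H) Gamma.
Proof.
have k_gt0 : 0 < k by apply: ltnW.
have [|y yN] := @exists_non_double Gamma.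
  by rewrite card_Gamma oddM oddX (gtn_eqF k_gt0).
pose d := (y *+ (m + n))%R; pose i := (d *+ 2 ^ k.-1)%R.
have i2 : (i *+ 2 = 0)%R.
  by rewrite -!mulrnA -expnSr prednK // mulnC -card_Gamma mulrn_card.
have c0 : ((d + i) *+ 2 ^ k.-1 *+ 2 = 0)%R.
  by rewrite mulrnAC (mulrnDl 2) i2 addr0 mulrnAC.
have i_odd t : odd t -> (i *+ t = i)%R.
  move=> t_odd; rewrite -(odd_double_half t) t_odd -muln2 mulnC mulrnDr mulrnA i2.
  by rewrite mul0rn addr0.
(* With [m + n = 2 h + 1], [2 x = (m + n) y] would give [y = 2 (x - h y)]. *)
have dN x : (x *+ 2 != d)%R.
  apply: contra (yN (x - y *+ (m + n)./2)%R) => /eqP x2.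
  rewrite mulrnBl x2 -mulrnA muln2 subr_eq -mulrS -[_.+1]/(true + _).
  by rewrite /d -{1}[m + n]odd_double_half oddD (negbTE m_even) n_odd.
(* Since [k >= 2], [i] is the double of [2 ^ (k - 2) d], so [d] would be a double as well. *)
have cN x : (x *+ 2 != d + i)%R.
  apply: contra (dN (x - d *+ 2 ^ (k - 2))%R) => /eqP x2.
  rewrite mulrnBl x2 -mulrnA -expnSr subr_eq /i.
  by rewrite subn2 prednK // -subn1 subn_gt0.
have [|X cardX Xcl] := @reflections_closed_subset _ d i k m dN cN i2 k_ge2.
  by rewrite card_Gamma leq_mul2l leq_addr orbT.
have [_ [v [v' [vbij vv']]]] := H_balanced.
have vP h j : (v j \in nbhd h) = (v' j \in nbhd h) by apply: nbhd_twin.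
have [||l1 [l1I l1X l1c]] := exists_balanced_labelling (m := m) vbij cN (X := X).
- by move=> x; have [] := Xcl x.
- by rewrite cardX card_H mulnC.
have [||l2 [l2I l2X l2d]] := exists_balanced_labelling (m := n) vbij dN (X := ~: X).
- by move=> x; rewrite !inE; have [->] := Xcl x.
- by apply/eqP; rewrite -(eqn_add2l #|X|) cardsC cardX card_H card_Gamma mulnDr [n * _]mulnC.
pose l (p : lexprod (complete_bipartite m n) H) : Gamma :=
  match p.1 with inl a => l1 (a, p.2) | inr b => l2 (b, p.2) end.
exists l; split.
  apply: inj_card_bij; last first.
    by rewrite card_prod card_sum !card_ord card_H card_Gamma mulnC.
  move=> [[a1|b1] h1] [[a2|b2] h2]; rewrite /l /=.
  - by move/l1I=> [-> ->].
  - by move=> e; have := l2X (b2, h2); rewrite inE -e l1X.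
  - by move=> e; have := l2X (b1, h1); rewrite inE e l1X.
  - by move/l2I=> [-> ->].
have half_reg (h : H) : #|nbhd h|./2 = r by rewrite H_regular mul2n doubleK.
have half_H : #|[set: H]|./2 = 2 ^ k.-1.
  by rewrite cardsT card_H -{1}(prednK k_gt0) expnS mul2n doubleK.
have vT j : (v j \in [set: H]) = (v' j \in [set: H]) by rewrite !inE.
exists (d *+ r)%R => -[[a|b] h]; rewrite lexprod_weight /=.
- rewrite (sum_twins vbij (vP h) (l1c a)) half_reg.
  rewrite (eq_bigr (fun=> i)) => [|[a'|b'] g]; last 2 first.
  + by rewrite inE in g.
  + by rewrite (sum_twins vbij vT (l2d b')) half_H.
  rewrite sumr_const card_nbhd_inl.
  (* Both [r] and [n] are odd, so the stray terms add up to [i + i = 0]. *)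
  by rewrite mulrnDl !i_odd // -addrA -mulr2n i2 addr0.
- rewrite (sum_twins vbij (vP h) (l2d b)) half_reg.
  rewrite (eq_bigr (fun=> (d + i) *+ 2 ^ k.-1)%R) => [|[a'|b'] g]; last 2 first.
  + by rewrite (sum_twins vbij vT (l1c a')) half_H.
  + by rewrite inE in g.
  (* The [m] equal copy sums cancel in pairs by [c0]. *)
  rewrite sumr_const card_nbhd_inr -(even_halfK m_even) -mul2n mulrnA.
  by rewrite c0 mul0rn addr0.
Qed.
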